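(* Let $\mathcal K$ be a knot that is the closure of a braid on $4$ strands, and suppose that its Jones polynomial is trivial, $J^{\mathcal K}(q)=1$, while its HOMFLY-PT polynomial is non-trivial, $H^{\mathcal K}(q,A)\neq 1$. Then $$H^{\mathcal K}(q,A)=1+(A^2-q^2)(A^2-q^4)(A^2-q^{-2})(A^2-q^{-4})\cdot F(q,A),$$ where, for some non-negative integer $m$, $F$ is one of the two functions $$F=-\sum_{j=0}^{m}\frac{[2j+4]_q\,[j+3]_q\,[j+1]_q}{[3]_q\,[4]_q}\,A^{-2j-8}\qquad\text{or}\qquad F=-\sum_{j=0}^{m}\frac{[2j+4]_q\,[j+3]_q\,[j+1]_q}{[3]_q\,[4]_q}\,A^{2j}.$$
   Context: $[x]_q=\frac{q^x-q^{-x}}{q-q^{-1}}$. The HOMFLY-PT polynomial $H(q,A)$ of oriented links is the invariant equal to $1$ on the unknot and satisfying the skein relation $A\,H(L_+)-A^{-1}H(L_-)=(q-q^{-1})H(L_0)$, where $L_+,L_-,L_0$ are diagrams identical except near one point, where they have respectively a positive crossing, a negative crossing, and the oriented smoothing. The Jones polynomial is $J(q)=H(q,A=q^2)$; equivalently it equals $1$ on the unknot and satisfies $q^2J(L_+)-q^{-2}J(L_-)=(q-q^{-1})J(L_0)$. *)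

(* Defs.v *)
From HB Require Import structures.
From mathcomp Require Import all_boot all_order all_algebra.
From mathcomp Require Import generic_quotient fraction.
From Stdlib Require Import Relations.Relation_Operators.

Set Implicit Arguments.
Unset Strict Implicit.
Unset Printing Implicit Defensive.

Import GRing.Theory.
Local Open Scope ring_scope.

(** * Oriented link diagrams

  A generic planar diagram is cut by horizontal lines into elementary slices,
  read from bottom to top.  On each horizontal line the diagram meets finitely
  many strands, numbered 0, 1, 2, ... from left to right; the state of the line
  is the list of their orientations, [true] meaning upward.

  - [Cup i o] is a local minimum creating strands [i] and [i.+1]; its left leg
    has orientation [o], its right leg the opposite one.
  - [Cap i] is a local maximum joining strands [i] and [i.+1].
  - [Cross i s] crosses strands [i] and [i.+1]; [s] tells whether the strand
    going from bottom left to top right is the overpass. *)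
Inductive slice : Type :=
  | Cup of nat & bool
  | Cap of nat
  | Cross of nat & bool.

Definition position (e : slice) : nat :=
  match e with Cup i _ => i | Cap i => i | Cross i _ => i end.
Definition inputs (e : slice) : nat :=
  match e with Cup _ _ => 0 | Cap _ => 2 | Cross _ _ => 2 end.
Definition outputs (e : slice) : nat :=
  match e with Cup _ _ => 2 | Cap _ => 0 | Cross _ _ => 2 end.
Definition move_to (k : nat) (e : slice) : slice :=
  match e with Cup _ o => Cup k o | Cap _ => Cap k | Cross _ s => Cross k s end.

(* State above a slice, given the state below it; [None] if the slice does not
   fit there (strands missing, or incompatible orientations at a cap). *)
Definition step (e : slice) (st : seq bool) : option (seq bool) :=
  match e with
  | Cup i o =>
      if (i <= size st)%N then Some (take i st ++ o :: ~~ o :: drop i st)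
      else None
  | Cap i =>
      if drop i st is x :: y :: st' then
        if x != y then Some (take i st ++ st') else None
      else None
  | Cross i _ =>
      if drop i st is x :: y :: st' then Some (take i st ++ y :: x :: st')
      else None
  end.

Fixpoint run (D : seq slice) (st : seq bool) : option (seq bool) :=
  if D is e :: D' then obind (run D') (step e st) else Some st.

Definition is_link (D : seq slice) : Prop := run D [::] = Some [::].

(** ** Components *)

(* [(t, k)] is the point where strand [k] meets the line below slice [t]. *)
Definition is_point (D : seq slice) (p : nat * nat) : Prop :=
  exists2 st, run (take p.1 D) [::] = Some st & (p.1 <= size D)%N /\
                                              (p.2 < size st)%N.

Inductive arc (D : seq slice) : nat * nat -> nat * nat -> Prop :=
  | arc_left t e k of onth D t = Some e & (k < position e)%N :
      arc D (t, k) (t.+1, k)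
  | arc_right t e k of onth D t = Some e :
      arc D (t, position e + inputs e + k)%N
            (t.+1, position e + outputs e + k)%N
  | arc_cup t i o of onth D t = Some (Cup i o) :
      arc D (t.+1, i) (t.+1, i.+1)
  | arc_cap t i of onth D t = Some (Cap i) :
      arc D (t, i) (t, i.+1)
  | arc_up t i s of onth D t = Some (Cross i s) :
      arc D (t, i) (t.+1, i.+1)
  | arc_down t i s of onth D t = Some (Cross i s) :
      arc D (t, i.+1) (t.+1, i).

Definition same_component (D : seq slice) : nat * nat -> nat * nat -> Prop :=
  clos_refl_sym_trans _ (arc D).

(* A knot is a link with exactly one component. *)
Definition is_knot (D : seq slice) : Prop :=
  [/\ is_link D,
      exists p, is_point D p &
      forall p p', is_point D p -> is_point D p' -> same_component D p p'].

(** ** Isotopy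

  The Reidemeister moves, together with the planar isotopies that change the
  slicing.  Orientations play no role in the list: every move is allowed with
  each orientation of the strands for which both sides are diagrams. *)
Inductive local_move : seq slice -> seq slice -> Prop :=
  | reidemeister1_right i o s :
      local_move [:: Cup i.+1 o; Cross i s; Cap i.+1] [::]
  | reidemeister1_left i o s :
      local_move [:: Cup i o; Cross i.+1 s; Cap i] [::]
  | reidemeister2 i s :
      local_move [:: Cross i s; Cross i (~~ s)] [::]
  (* [a], [b], [c] record the relative heights of the strands 1 and 2, 1 and 3,
     2 and 3; the side condition says that they come from an ordering. *)
  | reidemeister3 i a b c of (a == b) || (b == c) :
      local_move [:: Cross i a; Cross i.+1 b; Cross i c]
                 [:: Cross i.+1 c; Cross i b; Cross i.+1 a]
  | zigzag_left i o : local_move [:: Cup i o; Cap i.+1] [::]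
  | zigzag_right i o : local_move [:: Cup i.+1 o; Cap i] [::]
  | slide_cap i s :
      local_move [:: Cross i s; Cap i.+1] [:: Cross i.+1 (~~ s); Cap i]
  | slide_cup i o s :
      local_move [:: Cup i o; Cross i.+1 s] [:: Cup i.+1 o; Cross i (~~ s)]
  (* Slices acting on disjoint groups of strands, the one of [e'] being [k]
     strands to the right of that of [e]. *)
  | exchange e e' k :
      local_move [:: move_to (position e + inputs e + k)%N e'; e]
                 [:: e; move_to (position e + outputs e + k)%N e'].

Definition isotopy_invariant (T : Type) (H : seq slice -> T) : Prop :=
  forall l r u v, local_move u v ->
    is_link (l ++ u ++ r) -> is_link (l ++ v ++ r) ->
    H (l ++ u ++ r) = H (l ++ v ++ r).

(** ** Skein relations *)

(* The crossings and the oriented smoothing of strands [i] and [i.+1], of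
   orientations [x] and [y] below the crossing.  For two upward strands, the
   crossing is positive when the overpass goes from bottom left to top right;
   reversing one of the strands changes the sign. *)
Definition positive_crossing (i : nat) (x y : bool) : seq slice :=
  [:: Cross i (x == y)].
Definition negative_crossing (i : nat) (x y : bool) : seq slice :=
  [:: Cross i (x != y)].
Definition smoothing (i : nat) (x y : bool) : seq slice :=
  if x == y then [::] else [:: Cap i; Cup i y].

Definition skein (K : fieldType) (a z : K) (H : seq slice -> K) : Prop :=
  forall l r i st, run l [::] = Some st -> (i.+1 < size st)%N ->
    let x := nth true st i in let y := nth true st i.+1 in
    is_link (l ++ positive_crossing i x y ++ r) ->
    a * H (l ++ positive_crossing i x y ++ r)
      - a^-1 * H (l ++ negative_crossing i x y ++ r)
    = z * H (l ++ smoothing i x y ++ r).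

Definition unknot (o : bool) : seq slice := [:: Cup 0 o; Cap 0].

(** * Polynomials *)

(* The fields Q(q) and Q(q)(A). *)
Definition Qq : fieldType := {fraction {poly rat}}.
Definition QqA : fieldType := {fraction {poly Qq}}.

Definition q : Qq := FracField.tofrac 'X.
Definition qA : QqA := FracField.tofrac q%:P.
Definition A : QqA := FracField.tofrac 'X.

(* Value at [a] of a rational function, computed on its reduced form. *)
Definition frac_eval (F : fieldType) (a : F) (f : {fraction {poly F}}) : F :=
  let n := \n_(repr f) in let d := \d_(repr f) in
  (n %/ gcdp n d).[a] / (d %/ gcdp n d).[a].

Lemma frac_evalE (F : fieldType) (a : F) (n d : {poly F}) : d.[a] != 0 ->
  frac_eval a (FracField.tofrac n / FracField.tofrac d) = n.[a] / d.[a].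
Proof.
have numden (f : {fraction {poly F}}) :
    f = FracField.tofrac \n_(repr f) / FracField.tofrac \d_(repr f).
  have dn0 : \d_(repr f) != 0 by exact: denom_ratioP.
  apply: (canRL (mulfK _)); first by rewrite tofrac_eq0.
  rewrite -{1}[f]reprK; unlock FracField.tofrac.
  rewrite -[LHS]FracField.pi_mul; apply/eqmodP => /=.
  rewrite FracField.equivfE /FracField.mulf !numden_Ratio ?oner_eq0 ?mulr1 //.
  by rewrite mulrC.
move=> da0; have d0 : d != 0 by apply: contraNneq da0 => ->; rewrite horner0.
set f := _ / _; rewrite /frac_eval.
have := numden f; set N := \n_(repr f); set D := \d_(repr f) => fE.
have D0 : D != 0 by exact: denom_ratioP.
have ND : N * d = n * D.
  apply/eqP; rewrite -tofrac_eq !rmorphM /=; apply/eqP.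
  have /eqP := fE; rewrite /f eqr_div ?tofrac_eq0 // => /eqP ->.
  by rewrite mulrC.
set g := gcdp N D.
have g0 : g != 0 by rewrite gcdp_eq0 negb_and D0 orbT.
have NE : N = (N %/ g) * g by rewrite divpK ?dvdp_gcdl.
have DE : D = (D %/ g) * g by rewrite divpK ?dvdp_gcdr.
have cop : coprimep (D %/ g) (N %/ g).
  by rewrite coprimep_sym coprimep_div_gcd // D0 orbT.
have E : (N %/ g) * d = n * (D %/ g).
  by apply: (mulIf g0); rewrite mulrAC -NE ND {1}DE mulrA.
have /dvdpP[c dE] : D %/ g %| d.
  by rewrite -(Gauss_dvdpr _ cop) E dvdp_mull.
have Da0 : (D %/ g).[a] != 0.
  by apply: contraNneq da0 => Da; rewrite dE hornerM Da mulr0.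
by apply/eqP; rewrite eqr_div // -!hornerM E.
Qed.

(* Quantum number [n]_x. *)
Definition qnum (K : fieldType) (x : K) (n : nat) : K :=
  (x ^+ n - x ^- n) / (x - x^-1).

Record is_HOMFLY (H : seq slice -> QqA) : Prop := IsHOMFLY {
  HOMFLY_invariant : isotopy_invariant H;
  HOMFLY_unknot : forall o, H (unknot o) = 1;
  HOMFLY_skein : skein A (qA - qA^-1) H }.

Definition jones (H : seq slice -> QqA) (D : seq slice) : Qq :=
  frac_eval (q ^+ 2) (H D).

(** * Braids *)

(* Words in the standard generators of the braid group on [n] strands and their
   inverses: [(i, true)] is the positive crossing of strands [i] and [i.+1],
   [(i, false)] the negative one. *)
Definition braid_word (n : nat) : Type := seq ('I_n.-1 * bool).

(* The braid, with all strands upward, closed by [n] nested arcs on its right. *)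
Definition braid_closure (n : nat) (w : braid_word n) : seq slice :=
  [seq Cup k true | k <- iota 0 n]
  ++ [seq Cross (g.1 : 'I_n.-1) g.2 | g <- w]
  ++ [seq Cap k | k <- rev (iota 0 n)].

Lemma braid_closure_link (n : nat) (w : braid_word n) :
  is_link (braid_closure w).
Proof.
have runcat D D' st : run (D ++ D') st = obind (run D') (run D st).
  by elim: D st => //= e D IH st; case: (step e st).
have nest k : nseq k.+1 true ++ nseq k.+1 false
    = nseq k true ++ true :: false :: nseq k false.
  by rewrite -{1}addn1 nseqD -catA.
have up k : run [seq Cup i true | i <- iota 0 k] [::]
    = Some (nseq k true ++ nseq k false).
  elim: k => // k IH; rewrite -{1}addn1 iotaD map_cat runcat IH nest /= add0n.
  rewrite size_cat !size_nseq leq_addr take_cat drop_cat size_nseq ltnn subnn.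
  by rewrite take0 drop0 cats0.
have down k : run [seq Cap i | i <- rev (iota 0 k)]
    (nseq k true ++ nseq k false) = Some [::].
  elim: k => // k IH; rewrite -{1}addn1 iotaD rev_cat map_cat nest /= add0n.
  by rewrite drop_cat take_cat size_nseq ltnn subnn /= cats0 IH.
have mid (s : seq bool) : run [seq Cross (g.1 : 'I_n.-1) g.2 | g <- w]
    (nseq n true ++ s) = Some (nseq n true ++ s).
  elim: w => //= -[i b] w' IH /=.
  have lt_in : (i.+1 < n)%N by have := ltn_ord i; case: (n) i.
  have -> : nseq n true ++ s
      = nseq i true ++ true :: true :: (nseq (n - i.+2) true ++ s).
    by rewrite -{1}(subnKC lt_in) -addn2 -addnA nseqD -catA.
  rewrite drop_cat take_cat size_nseq ltnn subnn /= cats0.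
  rewrite -[_ ++ _ :: _](_ : nseq n true ++ s = _) ?IH //.
  by rewrite -{1}(subnKC lt_in) -addn2 -addnA nseqD -catA.
by rewrite /is_link /braid_closure runcat up /= runcat mid /= down.
Qed.

(* Main.v *)
(* Let e = writhe + 3.  Skein, Reidemeister and destabilization moves reduce the
   closure of a 4-braid to unlinks, as in the Hecke algebra, and show that
   H = A^(-e) P(A^2) with deg P <= 3, where P(q^2) = q^e because H specializes to
   1 at A = q.  A trivial Jones polynomial means P(q^4) = q^(2e).  The
   coefficients of P are rational functions of z = q - 1/q of parity e.  The
   substitution q -> -q in P(q^4) = q^(2e) therefore shows that e = 2n is even,
   and q -> 1/q gives the values of P at q^(-2) and q^(-4).  Thus P interpolates
   x^n at the four points q^(+-2), q^(+-4).  If 0 <= n <= 3 then P = x^n and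
   H = 1; otherwise 1 - x^(-n) P(x) is the product of the four linear factors and
   of a truncation of the generating series of the complete symmetric functions of
   these points, which are the coefficients of F. *)
From HB Require Import structures.
Require Import Defs.
From mathcomp Require Import all_boot all_order all_algebra.
From mathcomp Require Import generic_quotient fraction ring.
Set Implicit Arguments.
Unset Strict Implicit.
Unset Printing Implicit Defensive.
Import GRing.Theory.
Local Open Scope ring_scope.

(** * Reduction of braid words *)

Definition word : Type := seq (nat * bool).
Definition below (N : nat) (w : word) : bool := all (fun g => g.1 < N)%N w.
Definition occurrences (N : nat) (w : word) : nat :=
  count (fun g => g.1 == N) w.

(** The relations of the Hecke algebra, read as closure properties of a predicate. Only the
    directions consumed by the reduction are demanded; far commutation is used both ways. *)
Record skein_closed (G : word -> Prop) : Prop := SkeinClosed {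
  closed_skein l r i s :
    G (l ++ (i, ~~ s) :: r) -> G (l ++ r) -> G (l ++ (i, s) :: r);
  closed_cancel l r i s : G (l ++ r) -> G (l ++ (i, s) :: (i, ~~ s) :: r);
  closed_braid l r i :
    G (l ++ [:: (i, true), (i.+1, true), (i, true) & r]) ->
    G (l ++ [:: (i.+1, true), (i, true), (i.+1, true) & r]);
  closed_comm l r i j s t : (i.+1 < j)%N ->
    G (l ++ [:: (i, s), (j, t) & r]) <-> G (l ++ [:: (j, t), (i, s) & r]) }.

Lemma skein_closed_context G l r :
  skein_closed G -> skein_closed (fun w => G (l ++ w ++ r)).
Proof.
case=> sk can br com; split=> l' r' i.
- by move=> s; rewrite -!(catA l') !(catA l); apply: sk.
- by move=> s; rewrite -!(catA l') !(catA l); apply: can.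
- by rewrite -!(catA l') !(catA l); apply: br.
- by move=> j s t lij; rewrite -!(catA l') !(catA l); apply: com.
Qed.

Lemma closed_commute_word G N m t l r : skein_closed G -> below N m ->
  G (l ++ m ++ (N.+1, t) :: r) <-> G (l ++ (N.+1, t) :: m ++ r).
Proof.
move=> Gc; elim: m l => [|[i s] m IH] l //= /andP[lt_iN lowm].
rewrite -cat_rcons; apply: iff_trans (IH _ lowm) _.
by rewrite cat_rcons; apply: closed_comm.
Qed.

Lemma split_top N w : below N.+1 w -> ~~ below N w ->
  exists l s r, [/\ w = l ++ (N, s) :: r, below N l & below N.+1 r].
Proof.
elim: w => [|[i s] w IH] //= /andP[leiN loww].
rewrite ltnS leq_eqVlt in leiN; case/orP: leiN => [/eqP ->|lt_iN] nlow.
  by exists [::], s, w.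
have [|l [t [r [-> lowl lowr]]]] := IH loww; first by rewrite lt_iN in nlow.
by exists ((i, s) :: l), t, r; split; rewrite //= lt_iN.
Qed.

Lemma below_occurrences N w : below N w -> occurrences N w = 0%N.
Proof.
by elim: w => [|[i s] w IH] //= /andP[lt_iN /IH ->]; rewrite ltn_eqF.
Qed.

Lemma belowS N w : below N w -> below N.+1 w.
Proof. by apply: sub_all => g; apply: leqW. Qed.

Lemma below_cat N u v : below N (u ++ v) = below N u && below N v.
Proof. exact: all_cat. Qed.

Lemma closed_positive G l r i s : skein_closed G ->
  G (l ++ (i, true) :: r) -> G (l ++ r) -> G (l ++ (i, s) :: r).
Proof. by move=> Gc; case: s => // Gt; apply: closed_skein. Qed.

(** Strong induction on the number of occurrences of the top generator. The last hypothesis treats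
    two consecutive occurrences, made positive, and may use any replacement that contains at most
    one. *)
Lemma reduce_top N G : skein_closed G ->
    (forall u, below N u -> G u) ->
    (forall u v, below N u -> below N v -> G (u ++ (N, true) :: v)) ->
    (forall l m r, below N m ->
      (forall u, below N.+1 u -> (occurrences N u <= 1)%N -> G (l ++ u ++ r)) ->
      G (l ++ (N, true) :: m ++ (N, true) :: r)) ->
  forall w, below N.+1 w -> G w.
Proof.
move=> Gc G0 G1 G2 w; have [k] := ubnP (occurrences N w).
elim: k w => // k IHk w; rewrite ltnS => lek loww.
have [|/(split_top loww)[l [s [r [Dw lowl lowr]]]]] := boolP (below N w).
  exact: G0.
have cat_low u v : below N.+1 u -> below N.+1 v -> below N.+1 (u ++ v).
  by rewrite below_cat => -> ->.
have occ_cat u v : occurrences N (u ++ v) = (occurrences N u + occurrences N v)%N.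
  exact: count_cat.
have cntl := below_occurrences lowl; have low'l := belowS lowl.
move: lek; rewrite Dw occ_cat /= eqxx cntl add0n add1n -/(occurrences _ _) => lek.
(* Fixing the sign of a letter costs the word without it, which has one occurrence fewer. *)
apply: closed_positive => //; last first.
  by apply: IHk; rewrite ?occ_cat ?cntl //; apply: cat_low.
have [|/(split_top lowr)[m [t [r' [Dr lowm lowr']]]]] := boolP (below N r).
  exact: G1.
have cntm := below_occurrences lowm; have low'm := belowS lowm.
move: lek; rewrite Dr occ_cat /= eqxx cntm add0n add1n -/(occurrences _ _) => lek.
have lowN b : below N.+1 [:: (N, b)] by rewrite /= ltnSn.
(* Two top letters are removed and at most one comes back, so the count drops. *)
have IH u : below N.+1 u -> (occurrences N u <= 1)%N -> G (l ++ u ++ r').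
  move=> lowu cntu; apply: IHk; last by rewrite !cat_low.
  by rewrite !occ_cat cntl add0n; apply: leq_ltn_trans lek; rewrite -add1n leq_add2r.
rewrite -cat_rcons catA; apply: closed_positive => //.
  by rewrite -catA cat_rcons; apply: G2.
rewrite cat_rcons -catA /= -cat_cons; apply: IH.
  by apply: (cat_low [:: _]).
by rewrite /= eqxx -/(occurrences _ _) cntm.
Qed.

(** The quadratic relation: the skein move turns the second letter into the inverse of the first,
    and the pair cancels. *)
Lemma closed_square G i l r : skein_closed G ->
  G (l ++ r) -> G (l ++ (i, true) :: r) ->
  G (l ++ [:: (i, true), (i, true) & r]).
Proof.
move=> Gc Glr Gr; rewrite -cat_rcons; apply: closed_skein => //.
  by rewrite cat_rcons; apply: (@closed_cancel G Gc _ _ _ true).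
by rewrite cat_rcons.
Qed.

(* The analogue for words of the decomposition [H_(N+1) = H_N + H_N g_N H_N] of
   Hecke algebras. *)
Lemma hecke_ind N G : skein_closed G ->
    (forall u, below N u -> G u) ->
    (forall u v, below N u -> below N v -> G (u ++ (N, true) :: v)) ->
  forall w, below N.+1 w -> G w.
Proof.
elim: N G => [|N IHN] G Gc G0 G1; apply: reduce_top => // l m r lowm IH.
  case: m lowm => //= _; apply: closed_square => //.
    exact: (IH [::]).
  exact: (IH [:: _]).
have occ_cat u v :
    occurrences N.+1 (u ++ v) = (occurrences N.+1 u + occurrences N.+1 v)%N.
  exact: count_cat.
(* The induction hypothesis is applied to the middle word [m], in the context of the two letters [t]
   around it; this is why [G] is generalized. *)
move: m lowm; set t := (N.+1, true).
have Gc' := skein_closed_context (l ++ [:: t]) (t :: r) Gc.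
suff: forall m, below N.+1 m -> G ((l ++ [:: t]) ++ m ++ t :: r).
  by move=> Gm m /Gm; rewrite -catA.
have low1 u : below N u -> below N.+1 u by exact: belowS.
have low2 u : below N u -> below N.+2 u by move=> /low1; apply: belowS.
have occ0 u : below N u -> occurrences N.+1 u = 0%N.
  by move=> /low1; apply: below_occurrences.
apply: IHN => // [u lowu|u v lowu lowv].
  rewrite -catA /=; apply/closed_commute_word => //.
  rewrite catA; apply: closed_square => //; rewrite -catA.
    apply: IH; [exact: low2|by rewrite occ0].
  rewrite -cat_rcons -cats1; apply: IH; first by rewrite below_cat /= ltnSn low2.
  by rewrite occ_cat /= eqxx occ0.
(* With one letter [N] in the middle, both [t] commute next to it, and the braid relation leaves a
   single [t]. *)
rewrite -!catA /=; apply/closed_commute_word => //.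
have ->: l ++ u ++ t :: (N, true) :: v ++ t :: r
    = (l ++ u ++ [:: t; (N, true)]) ++ v ++ t :: r by rewrite -!catA.
apply/closed_commute_word => //; rewrite -!catA /= catA.
apply: closed_braid => //.
have ->: (l ++ u) ++ [:: (N, true), t, (N, true) & v ++ r]
    = l ++ (u ++ [:: (N, true), t, (N, true) & v]) ++ r by rewrite -!catA.
have lowN : below N.+2 [:: (N, true); t; (N, true)] by rewrite /= ltnSn leqnSn.
rewrite -[[:: _, _, _ & v]]/([:: _; _; _] ++ v); apply: IH.
  by rewrite !below_cat lowN !low2.
by rewrite !occ_cat /= eqxx ltn_eqF // !occ0.
Qed.

(** * Closures of braids as sliced diagrams *)

Definition crosses (w : word) : seq slice := [seq Cross g.1 g.2 | g <- w].

Lemma crosses_cons i s w : crosses ((i, s) :: w) = Cross i s :: crosses w.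
Proof. by []. Qed.

Lemma crosses_cat u v : crosses (u ++ v) = crosses u ++ crosses v.
Proof. exact: map_cat. Qed.

Definition cups (n : nat) : seq slice := [seq Cup k true | k <- iota 0 n].

Definition caps (n : nat) : seq slice := [seq Cap k | k <- rev (iota 0 n)].

Arguments cups : simpl never.
Arguments caps : simpl never.

Lemma cupsS n : cups n.+1 = cups n ++ [:: Cup n true].
Proof. by rewrite /cups -addn1 iotaD map_cat. Qed.

Lemma capsS n : caps n.+1 = Cap n :: caps n.
Proof. by rewrite /caps -addn1 iotaD rev_cat. Qed.

Definition closure (n : nat) (w : word) : seq slice :=
  cups n ++ crosses w ++ caps n.

(** The state at the level of the braid: its [n] upward strands, then the downward strands of the
    closing arcs. *)
Definition nested (n : nat) : seq bool := nseq n true ++ nseq n false.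

Lemma run_cat D D' st st' : run D st = Some st' -> run (D ++ D') st = run D' st'.
Proof. by elim: D st => [|e D IH] st /=; [case=> -> | case: (step e st)]. Qed.

Lemma run_cons e D st st' : step e st = Some st' -> run (e :: D) st = run D st'.
Proof. by move=> /= ->. Qed.

Lemma nestedS n : nested n.+1 = nseq n true ++ true :: false :: nseq n false.
Proof. by rewrite /nested -{1}addn1 nseqD -catA. Qed.

Lemma step_cup n : step (Cup n true) (nested n) = Some (nested n.+1).
Proof.
rewrite nestedS /nested /= size_cat !size_nseq leq_addr.
by rewrite take_cat drop_cat size_nseq ltnn subnn take0 drop0 cats0.
Qed.

Lemma step_cap n : step (Cap n) (nested n.+1) = Some (nested n).
Proof.
by rewrite nestedS /= drop_cat take_cat size_nseq ltnn subnn /= cats0.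
Qed.

Lemma step_cross n i s :
  (i < n)%N -> step (Cross i s) (nested n.+1) = Some (nested n.+1).
Proof.
move=> lt_in; rewrite /nested; set f := nseq _ false.
have -> : nseq n.+1 true ++ f
    = nseq i true ++ true :: true :: (nseq (n - i.+1) true ++ f).
  have ->: n.+1 = (i + (2 + (n - i.+1)))%N by rewrite !addnS -addSn subnKC.
  by rewrite !nseqD -!catA.
by rewrite /= drop_cat take_cat size_nseq ltnn subnn /= cats0.
Qed.

Lemma run_cups n : run (cups n) [::] = Some (nested n).
Proof.
elim: n => // n IH.
by rewrite cupsS (run_cat _ IH) (run_cons _ (step_cup n)).
Qed.

Lemma run_caps n : run (caps n) (nested n) = Some [::].
Proof.
elim: n => // n IH.
by rewrite capsS (run_cons _ (step_cap n)).
Qed.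

Lemma run_crosses n w :
  below n w -> run (crosses w) (nested n.+1) = Some (nested n.+1).
Proof.
elim: w => // -[i s] w IH /andP[lt_in loww].
by rewrite crosses_cons (run_cons _ (step_cross s lt_in)); apply: IH.
Qed.

Lemma closure_link n w : below n w -> is_link (closure n.+1 w).
Proof.
move=> loww; rewrite /is_link /closure (run_cat _ (run_cups _)).
by rewrite (run_cat _ (run_crosses loww)) run_caps.
Qed.

Lemma closure_move (T : Type) (H : seq slice -> T) n l u v r :
    isotopy_invariant H -> local_move (crosses u) (crosses v) ->
    below n (l ++ u ++ r) -> below n (l ++ v ++ r) ->
  H (closure n.+1 (l ++ u ++ r)) = H (closure n.+1 (l ++ v ++ r)).
Proof.
move=> Hi mv /closure_link + /closure_link.
rewrite /closure !crosses_cat -!(catA (crosses l)) -!(catA _ (crosses r)).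
by rewrite !(catA _ (crosses l)); apply: Hi.
Qed.

Lemma far_pos i n : (i < n)%N -> (i + 2 + (n - i.+1))%N = n.+1.
Proof. by move=> lt_in; rewrite addn2 addSn subnKC. Qed.

(** * Destabilization of closures *)

Section Invariance.
Variables (T : Type) (H : seq slice -> T).
Hypothesis Hi : isotopy_invariant H.

(** The last cup is the innermost one and lies to the right of all strands crossed by [w], so
    [exchange] moves it up one crossing at a time. *)
Lemma raise_cup n l w r : below n w ->
    run l [::] = Some (nested n.+1) -> run r (nested n.+2) = Some [::] ->
  H (l ++ Cup n.+1 true :: crosses w ++ r)
  = H (l ++ crosses w ++ Cup n.+1 true :: r).
Proof.
move=> loww; elim: w l loww => // -[i s] w IH l /andP[lt_in loww] runl runr.
rewrite crosses_cons.
have runl' : run (l ++ [:: Cross i s]) [::] = Some (nested n.+1).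
  by rewrite (run_cat _ runl) (run_cons _ (step_cross s lt_in)).
have := IH _ loww runl' runr; rewrite -!catA !cat1s => <-.
have := @Hi l (crosses w ++ r) [:: Cup n.+1 true; Cross i s]
  [:: Cross i s; Cup n.+1 true]; rewrite !cat_cons; apply.
- by have := exchange (Cross i s) (Cup 0 true) (n - i.+1); rewrite /= far_pos.
- rewrite /is_link (run_cat _ runl) (run_cons _ (step_cup _)).
  rewrite (run_cons _ (step_cross s (leqW lt_in))).
  by rewrite (run_cat _ (run_crosses (belowS loww))).
- rewrite /is_link (run_cat _ runl) (run_cons _ (step_cross s lt_in)).
  by rewrite (run_cons _ (step_cup _)) (run_cat _ (run_crosses (belowS loww))).
Qed.

Lemma lower_cap n l w r : below n w ->
    run l [::] = Some (nested n.+2) -> run r (nested n.+1) = Some [::] ->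
  H (l ++ crosses w ++ Cap n.+1 :: r) = H (l ++ Cap n.+1 :: crosses w ++ r).
Proof.
move=> loww; elim: w l loww => // -[i s] w IH l /andP[lt_in loww] runl runr.
rewrite crosses_cons.
have runl' : run (l ++ [:: Cross i s]) [::] = Some (nested n.+2).
  by rewrite (run_cat _ runl) (run_cons _ (step_cross s (leqW lt_in))).
have := IH _ loww runl' runr; rewrite -!catA !cat1s => ->.
have := @Hi l (crosses w ++ r) [:: Cap n.+1; Cross i s]
  [:: Cross i s; Cap n.+1]; rewrite !cat_cons => <- //.
- by have := exchange (Cross i s) (Cap 0) (n - i.+1); rewrite /= far_pos.
- rewrite /is_link (run_cat _ runl) (run_cons _ (step_cap _)).
  by rewrite (run_cons _ (step_cross s lt_in)) (run_cat _ (run_crosses loww)).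
- rewrite /is_link (run_cat _ runl).
  rewrite (run_cons _ (step_cross s (leqW lt_in))) (run_cons _ (step_cap _)).
  by rewrite (run_cat _ (run_crosses loww)).
Qed.

(** The second Markov move, for either sign: the innermost arc is shrunk around the only crossing of
    the last strand, by raising its cup past [u] and lowering its cap past [v]. *)
Lemma closure_destabilize n u v s : below n u -> below n v ->
  H (closure n.+2 (u ++ (n, s) :: v)) = H (closure n.+1 (u ++ v)).
Proof.
move=> lowu lowv; rewrite /closure !crosses_cat cupsS capsS crosses_cons -!catA cat1s.
rewrite raise_cup ?run_cups //; last first.
  rewrite (run_cons _ (step_cross s (ltnSn n))).
  rewrite (run_cat _ (run_crosses (belowS lowv))).
  by rewrite (run_cons _ (step_cap _)) run_caps.
have runl : run (cups n.+1 ++ crosses u) [::] = Some (nested n.+1).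
  by rewrite (run_cat _ (run_cups _)) run_crosses.
have := @lower_cap n (cups n.+1 ++ crosses u ++ [:: Cup n.+1 true; Cross n s]) v
  (caps n.+1) lowv.
rewrite -!catA !cat_cons !cat0s => ->; last exact: run_caps; last first.
  rewrite catA (run_cat _ runl) (run_cons _ (step_cup _)).
  by rewrite (run_cons _ (step_cross s (ltnSn n))).
(* Cup, crossing and cap are now adjacent and form a curl. *)
have := @Hi (cups n.+1 ++ crosses u) (crosses v ++ caps n.+1)
  [:: Cup n.+1 true; Cross n s; Cap n.+1] [::].
rewrite -!catA !cat_cons !cat0s; apply; first exact: reidemeister1_right.
  rewrite /is_link catA (run_cat _ runl) (run_cons _ (step_cup _)).
  rewrite (run_cons _ (step_cross s (ltnSn n))) (run_cons _ (step_cap _)).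
  by rewrite (run_cat _ (run_crosses lowv)) run_caps.
by rewrite /is_link catA (run_cat _ runl) (run_cat _ (run_crosses lowv)) run_caps.
Qed.

End Invariance.

Lemma closure_skein (K : fieldType) (a z : K) (H : seq slice -> K) n l r i :
    skein a z H -> below n (l ++ r) -> (i < n)%N ->
  a * H (closure n.+1 (l ++ (i, true) :: r))
    - a^-1 * H (closure n.+1 (l ++ (i, false) :: r))
  = z * H (closure n.+1 (l ++ r)).
Proof.
move=> Hs; rewrite below_cat => /andP[lowl lowr] lt_in.
have runl : run (cups n.+1 ++ crosses l) [::] = Some (nested n.+1).
  by rewrite (run_cat _ (run_cups _)) run_crosses.
have nthi j : (j <= n)%N -> nth true (nested n.+1) j = true.
  by move=> lejn; rewrite nth_cat size_nseq ltnS lejn nth_nseq ltnS lejn.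
have szi : (i.+1 < size (nested n.+1))%N.
  by rewrite size_cat !size_nseq ltnS ltn_addr.
have := Hs _ (crosses r ++ caps n.+1) i _ runl szi; cbv zeta.
rewrite (nthi i.+1 lt_in) (nthi i (ltnW lt_in)).
rewrite /positive_crossing /negative_crossing /smoothing eqxx /=.
rewrite /closure !crosses_cat !crosses_cons -!catA; apply.
rewrite catA /is_link (run_cat _ runl) (run_cons _ (step_cross _ lt_in)).
by rewrite (run_cat _ (run_crosses lowr)) run_caps.
Qed.

(** * HOMFLY polynomials of braid closures *)

Lemma exprz_succ (F : fieldType) (x : F) e : x != 0 -> x ^ (e + 1) = x ^ e * x.
Proof. by move=> x0; rewrite expfzDr // expr1z. Qed.

Lemma exprz_pred (F : fieldType) (x : F) e : x != 0 -> x ^ (e - 1) = x ^ e / x.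
Proof. by move=> x0; rewrite expfzDr // exprN1. Qed.

Lemma skein_scaled (F : fieldType) (a u w f g h : F) : a != 0 ->
  a * f - a^-1 * g = w * h -> f * (u * a) = g * (u / a) + w * (h * u).
Proof. by move=> a0 E; rewrite mulrCA -mulrCA [w * _]mulrA -E; field. Qed.

(** * Laurent polynomials in [A] of bounded span and given parity *)

Section Laurent.
Variables (K L : fieldType) (emb : {rmorphism K -> L}) (q : K) (A : L).
Local Notation z := (q - q^-1).
Hypotheses (q0 : q != 0) (z0 : z != 0) (A0 : A != 0).

Lemma emb_z : emb z = emb q - (emb q)^-1.
Proof. by rewrite rmorphB fmorphV. Qed.

(* [theta] inverts the sign of [z], as [q -> - q] and [q -> 1 / q] do. *)
Definition flip (theta : {rmorphism K -> K}) : Prop := theta z = - z.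

(* The last condition says that [f] takes the value 1 at [A = q]. *)
Definition laurent (n : nat) (e : int) (f : L) : Prop :=
  exists P : {poly K}, [/\ (size P <= n.+1)%N,
    forall theta, flip theta -> map_poly theta P = (-1) ^ e *: P,
    f * A ^ e = (map_poly emb P).[A ^+ 2] & P.[q ^+ 2] = q ^ e].

Lemma laurent1 : laurent 0 0 1.
Proof.
exists 1; split; first by rewrite size_polyC oner_eq0.
- by move=> theta _; rewrite rmorph1 scale1r.
- by rewrite mulr1 rmorph1 hornerC.
- by rewrite hornerC.
Qed.

(** The three exponents are chosen so that the skein relation becomes [Q + z *: P]. As [z] is odd
    under [flip], the parities agree, and the value at [q ^+ 2] is q^(e-1) + (q - 1/q) q^e =
    q^(e+1). *)
Lemma laurent_succ n e f g h : A * f - A^-1 * g = (emb q - (emb q)^-1) * h ->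
  laurent n e h -> laurent n (e - 1) g -> laurent n (e + 1) f.
Proof.
rewrite -emb_z => fgh [P [szP symP hP Pq]] [Q [szQ symQ gQ Q2]].
exists (Q + z *: P); split.
- rewrite (leq_trans (size_polyD _ _)) // geq_max szQ.
  exact: leq_trans (size_scale_leq _ _) szP.
- move=> theta tz; rewrite rmorphD /= symQ // map_polyZ symP //= tz.
  rewrite exprz_pred ?exprz_succ ?oppr_eq0 ?oner_eq0 // invrN1.
  by rewrite scalerDr !scalerA !mulrN1 mulNr [z * _]mulrC mulNr.
- rewrite rmorphD /= map_polyZ hornerD hornerZ -gQ -hP.
  by rewrite exprz_pred ?exprz_succ ?A0 //; apply: skein_scaled A0 fgh.
- rewrite hornerD hornerZ Pq Q2 exprz_pred ?exprz_succ ?q0 //.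
  by rewrite mulrBl addrC [_ / _]mulrC subrK mulrC.
Qed.

Lemma laurent_pred n e f g h : A * f - A^-1 * g = (emb q - (emb q)^-1) * h ->
  laurent n e h -> laurent n (e + 1) f -> laurent n (e - 1) g.
Proof.
rewrite -emb_z => fgh [P [szP symP hP Pq]] [Q [szQ symQ fQ Q2]].
exists (Q - z *: P); split.
- rewrite (leq_trans (size_polyD _ _)) // geq_max szQ size_polyN.
  exact: leq_trans (size_scale_leq _ _) szP.
- move=> theta tz; rewrite rmorphB /= symQ // map_polyZ symP //= tz.
  rewrite exprz_pred ?exprz_succ ?oppr_eq0 ?oner_eq0 // invrN1.
  by rewrite scalerBr !scalerA !mulrN1 mulNr [z * _]mulrC mulNr.
- rewrite rmorphB /= map_polyZ hornerD hornerN hornerZ -fQ -hP.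
  rewrite exprz_pred ?exprz_succ ?A0 //.
  by rewrite (skein_scaled (A ^ e) A0 fgh) addrK.
- rewrite hornerD hornerN hornerZ Pq Q2 exprz_pred ?exprz_succ ?q0 //.
  by rewrite mulrBl [q * _]mulrC opprB addrC subrK mulrC.
Qed.

(** For a positive stabilization: the link is the same, while the writhe and the number of strands
    both grow by one. *)
Lemma laurent_stabilize n e f : laurent n e f -> laurent n.+1 (e + 2) f.
Proof.
have expr2z (F : fieldType) (x : F) : x != 0 -> x ^ (e + 2) = x ^ e * x ^+ 2.
  by move=> x0; rewrite expfzDr.
move=> [P [szP symP fP Pq]]; exists (P * 'X); split.
- by rewrite (leq_trans (size_polyMleq _ _)) // size_polyX addn2.
- move=> theta tz; rewrite rmorphM /= map_polyX symP // expr2z ?oppr_eq0 ?oner_eq0 //.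
  by rewrite sqrrN expr1n mulr1 scalerAl.
- by rewrite rmorphM /= map_polyX hornerMX -fP expr2z ?A0 // mulrA.
- by rewrite hornerMX Pq expr2z ?q0.
Qed.

(** For adding a split unknotted circle, which multiplies the invariant by (A - 1/A) / z. The
    division by z makes the coefficients rational functions, still of definite parity. *)
Lemma laurent_unlink n e f g : A * f - A^-1 * f = (emb q - (emb q)^-1) * g ->
  laurent n e f -> laurent n.+1 (e + 1) g.
Proof.
rewrite -emb_z => fg [P [szP symP fP Pq]].
exists (z^-1 *: (P * ('X - 1))); split.
- rewrite (leq_trans (size_scale_leq _ _)) //.
  by rewrite (leq_trans (size_polyMleq _ _)) // size_XsubC addn2.
- move=> theta tz; rewrite map_polyZ rmorphM /= symP // fmorphV tz.
  rewrite rmorphB /= map_polyX rmorph1 exprz_succ ?oppr_eq0 ?oner_eq0 //.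
  by rewrite invrN -scalerAl !scalerA mulrN1 mulNr [_^-1 * _]mulrC mulNr.
- rewrite map_polyZ rmorphM rmorphB /= map_polyX rmorph1 hornerZ hornerM -fP.
  rewrite hornerD hornerN hornerX hornerC exprz_succ ?A0 // fmorphV.
  have zA0 : emb z != 0 by rewrite fmorph_eq0 z0.
  apply: (canRL (mulKf zA0)); rewrite mulrA -fg.
  by field.
- rewrite hornerZ hornerM Pq hornerD hornerN hornerX hornerC.
  rewrite exprz_succ ?q0 //.
  have q21 : q ^+ 2 - 1 = z * q by rewrite mulrBl mulVf.
  by rewrite q21 mulrCA mulKf.
Qed.

End Laurent.

(** * The degree bound for closures of braids *)

Definition writhe (w : word) : int := \sum_(g <- w) (if g.2 then 1 else -1).

Lemma writhe_cat u v : writhe (u ++ v) = writhe u + writhe v.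
Proof. exact: big_cat. Qed.

Lemma writhe_cons g w : writhe (g :: w) = (if g.2 then 1 else -1) + writhe w.
Proof. exact: big_cons. Qed.

Section Closures.
Variables (K L : fieldType) (emb : {rmorphism K -> L}) (q : K) (A : L).
Hypotheses (q0 : q != 0) (z0 : q - q^-1 != 0) (A0 : A != 0).
Variable H : seq slice -> L.
Hypotheses (Hi : isotopy_invariant H) (Hu : forall o, H (unknot o) = 1)
  (Hs : skein A (emb q - (emb q)^-1) H).

(** The Morton-Franks-Williams bound for [n.+1] strands: the degrees in [A] lie between - writhe - n
    and - writhe + n. *)
Let good (n : nat) (w : word) : Prop :=
  laurent emb q A n (writhe w + n%:Z) (H (closure n.+1 w)).

(** The letter bound is part of the predicate because the moves of [skein_closed] concern arbitrary
    letters. All moves except the skein one preserve both the link and the writhe. *)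
Lemma good_skein_closed n : skein_closed (fun w => below n w -> good n w).
Proof.
split=> l r i; rewrite /good.
- move=> s Gs G0; rewrite below_cat => /and3P[lowl lt_in lowr].
  have {}lt_in : (i < n)%N := lt_in.
  have lowlr : below n (l ++ r) by rewrite below_cat lowl.
  have lows : below n (l ++ (i, ~~ s) :: r).
    by rewrite below_cat lowl /= lt_in.
  have E := closure_skein Hs lowlr lt_in; have := G0 lowlr; have := Gs lows.
  rewrite !writhe_cat !writhe_cons /=.
  set e := writhe l + writhe r + n%:Z.
  have eE x : writhe l + (x + writhe r) + n%:Z = e + x by rewrite /e; ring.
  rewrite !eE => {lows Gs}; case: s => /= Gs {}G0.
    exact: laurent_succ E G0 Gs.
  exact: laurent_pred E G0 Gs.
- move=> s G0 loww; have lowlr : below n (l ++ r).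
    by move: loww; rewrite !below_cat /= => /and4P[-> _ _ ->].
  have -> : writhe (l ++ [:: (i, s), (i, ~~ s) & r]) = writhe (l ++ r).
    by rewrite !writhe_cat !writhe_cons; case: s {loww} => /=; ring.
  rewrite (closure_move (u := [:: (i, s); (i, ~~ s)]) (v := [::]) Hi) //.
    exact: G0.
  exact: reidemeister2.
- move=> G0 loww; move: (loww); rewrite !below_cat /=.
  case/and5P=> lowl lt_in' lt_in _ lowr.
  have low' : below n (l ++ [:: (i, true), (i.+1, true), (i, true) & r]).
    by rewrite below_cat /= lowl lt_in lt_in'.
  rewrite -(closure_move (u := [:: (i, true); (i.+1, true); (i, true)])
    (v := [:: (i.+1, true); (i, true); (i.+1, true)]) Hi) //.
    have := G0 low'; rewrite !writhe_cat !writhe_cons; congr (laurent _ _ _ _ _ _).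
  exact: reidemeister3.
- move=> j s t lt_ij.
  have E : writhe (l ++ [:: (i, s), (j, t) & r])
      = writhe (l ++ [:: (j, t), (i, s) & r]).
    by rewrite !writhe_cat !writhe_cons; ring.
  have lowE : below n (l ++ [:: (i, s), (j, t) & r])
      = below n (l ++ [:: (j, t), (i, s) & r]).
    by rewrite !below_cat /=; congr (_ && _); apply: andbCA.
  have mv : local_move (crosses [:: (j, t); (i, s)]) (crosses [:: (i, s); (j, t)]).
    have := exchange (Cross i s) (Cross 0 t) (j - i.+2).
    by rewrite /= addn2 subnKC.
  have HE : below n (l ++ [:: (j, t), (i, s) & r]) ->
      H (closure n.+1 (l ++ [:: (i, s), (j, t) & r]))
      = H (closure n.+1 (l ++ [:: (j, t), (i, s) & r])).
    move=> loww; rewrite -(closure_move (u := [:: (j, t); (i, s)])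
      (v := [:: (i, s); (j, t)]) Hi) //.
    by have := loww; rewrite -lowE.
  by rewrite E lowE; split=> G0 loww; have := G0 loww; rewrite HE.
Qed.

(** Induction on the number of strands: [hecke_ind] leaves the words where the last generator is
    absent or occurs once. *)
Lemma laurent_closure n w : below n w -> good n w.
Proof.
elim: n w => [|n IHn] w.
  case: w => // _; rewrite /good /writhe big_nil /closure Hu.
  exact: laurent1.
move=> loww; move: w loww (loww).
apply: (@hecke_ind n (fun w => below n.+1 w -> good n.+1 w)).
- exact: good_skein_closed.
- move=> u lowu _.
  have lown : (n < n.+1)%N by [].
  have lowu1 : below n.+1 (u ++ [::]) by rewrite cats0 belowS.
  (* A last crossing of either sign appended to [u] destabilizes to the same link; its smoothing is
     the closure of [u] with an extra circle. *)
  have := closure_skein Hs lowu1 lown.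
  rewrite !(closure_destabilize Hi) // cats0 /good => E.
  have := laurent_unlink q0 z0 A0 E (IHn u lowu).
  by rewrite -addrA [n%:Z + 1]addrC -intS.
- move=> u v lowu lowv _; rewrite /good (closure_destabilize Hi) //.
  have lowuv : below n (u ++ v) by rewrite below_cat lowu.
  have := laurent_stabilize q0 A0 (IHn _ lowuv).
  rewrite !writhe_cat writhe_cons /=; congr (laurent _ _ _ _ _ _).
  by rewrite intS; ring.
Qed.

End Closures.

(** * Interpolation at q^2, q^4, q^-2, q^-4 *)

Section Interpolation.
Variables (L : fieldType) (t : L).
Hypotheses (t0 : t != 0) (t_free : forall k, t ^+ k.+1 != 1).

Let nodes : seq L := [:: t ^+ 2; t ^+ 4; t ^- 2; t ^- 4].
Let node (y : L) : L := (y - t ^+ 2) * (y - t ^+ 4) * (y - t ^- 2) * (y - t ^- 4).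
(** Here [e1] and [e2] are elementary symmetric functions of the nodes. Since the nodes are stable
    under inversion, the third one is [e1] again and the fourth is 1. *)
Let e1 : L := t ^+ 2 + t ^+ 4 + t ^- 2 + t ^- 4.
Let e2 : L := 2 + t ^+ 2 + t ^- 2 + t ^+ 6 + t ^- 6.

(** The complete homogeneous symmetric function of degree [j] in the four nodes. *)
Definition coeff (j : nat) : L :=
  qnum t (2 * j + 4) * qnum t (j + 3) * qnum t (j + 1) / (qnum t 3 * qnum t 4).

Lemma subV_neq0 k : t ^+ k.+1 - t ^- k.+1 != 0.
Proof.
apply/negP; rewrite subr_eq0 => /eqP tE; have := t_free (k.+1 + k).
rewrite -addnS exprD {1}tE mulVf ?eqxx //; exact: expf_neq0.
Qed.

Lemma nodeE y : node y = y ^+ 4 - e1 * y ^+ 3 + e2 * y ^+ 2 - e1 * y + 1.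
Proof. by rewrite /node /e1 /e2; field. Qed.

Lemma nodeV y : y != 0 -> node y^-1 = y ^- 4 * node y.
Proof. by move=> y0; rewrite !nodeE; field. Qed.

(* [coeff (j - 3)], extended by its three zeros at negative indices. *)
Let c (j : nat) : L :=
  let y := t ^+ j in
  (y ^+ 2 / t ^+ 2 - t ^+ 2 / y ^+ 2) * (y - y^-1) * (y / t ^+ 2 - t ^+ 2 / y)
  / ((t ^+ 3 - t ^- 3) * (t ^+ 4 - t ^- 4) * (t - t^-1)).

Lemma coeffE j : coeff j = c j.+3.
Proof.
rewrite /coeff /c /qnum.
have nt := subV_neq0 0; have nt3 := subV_neq0 2; have nt4 := subV_neq0 3.
rewrite expr1 in nt.
have -> : t ^+ (2 * j + 4) = (t ^+ j) ^+ 2 * t ^+ 4.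
  by rewrite exprD mulnC exprM.
have -> : t ^+ j.+3 = t ^+ j * t ^+ 3 by rewrite -exprD addn3.
rewrite !exprD expr1.
have y0 : t ^+ j != 0 by rewrite expf_neq0.
set y := t ^+ j in y0 *.
set a := t - t^-1 in nt *; set b := t ^+ 3 - t ^- 3 in nt3 *.
set d := t ^+ 4 - t ^- 4 in nt4 *.
field.
by rewrite t0 y0 nt nt3 nt4.
Qed.

(** Expanded, [c j] is a linear combination of the [j]-th powers of the nodes, and [node] is the
    characteristic polynomial of this recurrence. *)
Lemma c_rec j : c j.+4 = e1 * c j.+3 - e2 * c j.+2 + e1 * c j.+1 - c j.
Proof.
rewrite /c; set D := ((t ^+ 3 - _) * _ * _)^-1; rewrite !exprS.
have y0 : t ^+ j != 0 by rewrite expf_neq0.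
move: (t ^+ j) D y0 => y D y0; rewrite /e1 /e2; field.
by rewrite t0 y0.
Qed.

Lemma c0 : c 0 = 0. Proof. by rewrite /c expr0 invr1 subrr mulr0 !mul0r. Qed.
Lemma c1 : c 1 = 0. Proof. by rewrite /c expr1 divff ?expf_neq0 // subrr !mul0r. Qed.
Lemma c2 : c 2 = 0.
Proof. by rewrite /c /= divff ?expf_neq0 // subrr mulr0 mul0r. Qed.
Lemma c3 : c 3 = 1.
Proof.
rewrite -coeffE /coeff muln0 !add0n mulrAC [qnum t 3 * _]mulrC divff ?mul1r //.
  rewrite /qnum expr1 divff // -(expr1 t); exact: subV_neq0.
have n0 k : qnum t k.+1 != 0.
  by rewrite mulf_neq0 ?invr_neq0 ?subV_neq0 // -(expr1 t) subV_neq0.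
by rewrite mulf_neq0.
Qed.

Let tail (N : nat) : L * L * L * L :=
  (c N.+3, - c N + e1 * c N.+1 - e2 * c N.+2, - c N.+1 + e1 * c N.+2, - c N.+2).

(** As [node y] is also the product of the 1 - a y over the nodes a, its inverse is the power series
    with coefficients [coeff j]. Truncating it at order [N] leaves y^N times the cubic with
    coefficients [tail N]. *)
Lemma tail_sum N y :
  1 - node y * \sum_(0 <= j < N) coeff j * y ^+ j =
  y ^+ N * (let: (a0, a1, a2, a3) := tail N in
            a0 + a1 * y + a2 * y ^+ 2 + a3 * y ^+ 3).
Proof.
elim: N => [|N IH].
  rewrite big_geq // /tail /= c0 c1 c2 c3; ring.
rewrite big_nat_recr //= mulrDr opprD addrA IH nodeE coeffE (exprS y N).
rewrite /tail /= (c_rec N).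
ring.
Qed.

Lemma node_root a : a \in nodes -> [/\ a != 0, node a = 0 & a^-1 \in nodes].
Proof.
rewrite !inE => /or4P[] /eqP ->; rewrite ?invrK ?invr_eq0 ?expf_neq0 ?eqxx ?orbT //.
all: by split=> //; rewrite /node subrr !(mul0r, mulr0).
Qed.

Lemma uniq_nodes : uniq nodes.
Proof.
have neqV i j : t ^+ i.+1 != t ^- j.
  apply/eqP=> tE; have := t_free (i + j); rewrite -addSn exprD tE.
  by rewrite mulVf ?eqxx // expf_neq0.
have neq24 : t ^+ 2 != t ^+ 4.
  apply/eqP=> tE; have := t_free 1; apply/negP/negPn/eqP.
  by apply: (mulIf (expf_neq0 2 t0)); rewrite mul1r -exprD.
by rewrite /= !inE !negb_or !neqV neq24 (inj_eq invr_inj) neq24.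
Qed.

Lemma eq_on_nodes (P R : {poly L}) : (size P <= 4)%N -> (size R <= 4)%N ->
  {in nodes, forall a, P.[a] = R.[a]} -> P = R.
Proof.
move=> szP szR PR; apply/eqP; rewrite -subr_eq0; apply/eqP.
apply: (@roots_geq_poly_eq0 _ _ nodes); last 2 first.
- exact: uniq_nodes.
- by rewrite (leq_trans (size_polyD _ _)) // geq_max szP size_polyN.
by apply/allP=> a /PR E; rewrite rootE hornerD hornerN E subrr.
Qed.

Lemma horner_cubic (a0 a1 a2 a3 y : L) :
  (Poly [:: a0; a1; a2; a3]).[y] = a0 + a1 * y + a2 * y ^+ 2 + a3 * y ^+ 3.
Proof. by rewrite horner_Poly /=; ring. Qed.

(** Where [node] vanishes, [tail_sum] makes the cubic the interpolant of the power - N. *)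
Lemma tail_node N a : a \in nodes ->
  (let: (a0, a1, a2, a3) := tail N in
   a0 + a1 * a + a2 * a ^+ 2 + a3 * a ^+ 3) = a ^- N.
Proof.
move=> /node_root[a0 an _]; have := tail_sum N a.
rewrite an mul0r subr0 => E; apply: (mulfI (expf_neq0 N a0)).
by rewrite -E divff // expf_neq0.
Qed.

(** By uniqueness of cubic interpolation, [P] is a monomial for 0 <= n <= 3, the cubic of [tail] for
    n < 0, and that cubic reversed for n >= 4. *)
Lemma interpolate_power (P : {poly L}) (n : int) (x f : L) : x != 0 ->
    (size P <= 4)%N -> {in nodes, forall a, P.[a] = a ^ n} ->
    f * x ^ n = P.[x] -> f <> 1 ->
  exists m, f = 1 + node x * - \sum_(0 <= j < m.+1) coeff j * x ^- (j + 4)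
         \/ f = 1 + node x * - \sum_(0 <= j < m.+1) coeff j * x ^+ j.
Proof.
move=> x0 szP Pn fP f1.
case: n Pn fP => [n|m] Pn fP.
- have [lt_n4|le4n] := ltnP n 4.
    case: f1; apply: (mulIf (expf_neq0 n x0)); rewrite mul1r.
    have PX : P = 'X^n.
      by apply: eq_on_nodes; rewrite ?size_polyXn // => a /Pn ->; rewrite hornerXn.
    by rewrite -[LHS]/(f * x ^ n%:Z) fP PX hornerXn.
  exists (n - 4)%N; left; set m := (n - 4)%N.
  have nE : n = (m.+1 + 3)%N by rewrite addSnnS subnK.
  have := tail_sum m.+1 x^-1; have := @tail_node m.+1.
  case: (tail _) => [[[a0 a1] a2] a3] aE xE.
  (* With N = n - 3, the cubic takes the value a^N at 1/a, which is again a node; multiplying by a^3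
     reverses it and gives a^n. *)
  have PE : P = Poly [:: a3; a2; a1; a0].
    apply: eq_on_nodes; rewrite ?size_Poly // => a an; rewrite Pn // horner_cubic.
    have [an0 _ /aE] := node_root an; rewrite (exprVn a m.+1) invrK => E.
    rewrite nE -[LHS]/(a ^+ _) exprD -E; field. by [].
  apply: (mulIf (expf_neq0 n x0)); rewrite -[LHS]/(f * x ^ n%:Z) fP PE horner_cubic.
  rewrite mulrN.
  have -> : \sum_(0 <= j < m.+1) coeff j * x ^- (j + 4)
     = x ^- 4 * \sum_(0 <= j < m.+1) coeff j * x^-1 ^+ j.
    rewrite mulr_sumr; apply: eq_bigr => j _.
    by rewrite mulrCA exprVn exprD invfM [x ^- 4 * _]mulrC.
  rewrite [node x * _]mulrCA mulrA -nodeV // xE nE exprD exprVn; field.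
  by rewrite x0 expf_neq0.
(* Here n is - (m + 1), so N = m + 1 in [tail_node]. *)
- exists m; right.
  have := tail_sum m.+1 x; have := @tail_node m.+1.
  case: (tail _) => [[[a0 a1] a2] a3] aE xE.
  have PE : P = Poly [:: a0; a1; a2; a3].
    apply: eq_on_nodes; rewrite ?size_Poly // => a an.
    by rewrite Pn // horner_cubic aE.
  rewrite mulrN xE -horner_cubic -PE -fP NegzE -exprnN mulrCA mulfV ?mulr1 //.
  exact: expf_neq0.
Qed.

End Interpolation.

(** * The substitutions q -> - q and q -> 1 / q *)

(** The only possible pole of [f] is at 0, so it can be evaluated at [a] through [frac_evalE]. *)
Lemma frac_eval_exprz (F : fieldType) (a : F) (f : {fraction {poly F}})
    (p : {poly F}) (e : int) :
  a != 0 -> f * FracField.tofrac 'X ^ e = FracField.tofrac p ->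
  frac_eval a f * a ^ e = p.[a].
Proof.
have X0 : FracField.tofrac ('X : {poly F}) != 0 by rewrite tofrac_eq0 polyX_eq0.
have Xn0 n : FracField.tofrac ('X^n : {poly F}) != 0.
  by rewrite rmorphXn expf_neq0.
move=> a0; case: e => n; rewrite ?NegzE -?exprnN -?exprnP -rmorphXn => fE.
  have -> : f = FracField.tofrac p / FracField.tofrac 'X^n.
    exact: (canRL (mulfK (Xn0 n)) fE).
  by rewrite frac_evalE hornerXn ?mulfVK // expf_neq0.
have -> : f = FracField.tofrac (p * 'X^(n.+1)) / FracField.tofrac 1.
  by rewrite tofrac1 divr1 rmorphM; apply: (canRL (divfK (Xn0 n.+1)) fE).
rewrite frac_evalE hornerC ?oner_neq0 // divr1 hornerM hornerXn.
by rewrite mulfK // expf_neq0.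
Qed.

Lemma sign_even (K : fieldType) (e : int) :
  (-1 : K) != 1 -> (-1 : K) ^ e = 1 -> exists n : int, e = n + n.
Proof.
move=> neqN11; have even k : (-1 : K) ^+ k = 1 -> k = (k./2 + k./2)%N.
  rewrite -signr_odd addnn; have := odd_double_half k.
  by case: (odd k) => [_ /eqP|/esym //]; rewrite /= expr1 (negPf neqN11).
case: e => k; first by move=> /even ->; exists (k./2)%:Z; rewrite -PoszD.
rewrite NegzE -exprnN => /eqP; rewrite invr_eq1 => /eqP/even kE.
by exists (- (k.+1)./2%:Z); rewrite -opprD -PoszD -kE.
Qed.

Section Symmetry.
Variables (K : fieldType) (q : K) (P : {poly K}) (e : int).
Hypotheses (q0 : q != 0) (neqN11 : (-1 : K) != 1).
Variables (neg inv : {rmorphism K -> K}).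
Hypotheses (negq : neg q = - q) (invq : inv q = q^-1).
Hypothesis symP : forall theta : {rmorphism K -> K},
  flip q theta -> map_poly theta P = (-1) ^ e *: P.

(** The map [neg] fixes [q ^+ 4] and the nonzero value there, which forces the sign to be 1. Then
    [inv] fixes [P] and carries its values to the inverse nodes. *)
Lemma symmetric_nodes : P.[q ^+ 2] = q ^ e -> P.[q ^+ 4] = (q ^+ 2) ^ e ->
  exists2 n : int, e = n + n &
    {in [:: q ^+ 2; q ^+ 4; q ^- 2; q ^- 4], forall a, P.[a] = a ^ n}.
Proof.
move=> P2 P4.
have even_e : (-1 : K) ^ e = 1.
  have := horner_map neg P (q ^+ 4); rewrite /= symP; last first.
    by rewrite /flip rmorphB fmorphV negq invrN opprD.
  rewrite rmorphXn negq -[4%N]/(2 * 2)%N exprM sqrrN -exprM hornerZ P4.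
  rewrite fmorphXz rmorphXn negq sqrrN.
  by rewrite -[RHS]mul1r; apply/mulIf/expfz_neq0/expf_neq0.
have [n en] := sign_even neqN11 even_e; exists n => //.
have PV a : P.[a] = a ^ n -> P.[inv a] = inv a ^ n.
  move=> Pa; have := horner_map inv P a; rewrite /= symP; last first.
    by rewrite /flip rmorphB fmorphV invq invrK opprB.
  by rewrite even_e scale1r Pa fmorphXz.
have Pq2 : P.[q ^+ 2] = (q ^+ 2) ^ n by rewrite P2 en expfzDr // expr2 expfzMl.
have Pq4 : P.[q ^+ 4] = (q ^+ 4) ^ n.
  by rewrite P4 en expfzDr ?expf_neq0 // -[4%N]/(2 + 2)%N exprD expfzMl.
have := PV _ Pq2; have := PV _ Pq4; rewrite !rmorphXn invq !exprVn => Pq4' Pq2' a.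
by rewrite !inE => /or4P[] /eqP ->.
Qed.

End Symmetry.

Lemma trivial_jones (K L : fieldType) (emb : {rmorphism K -> L}) (q : K) (A f : L)
    (neg inv : {rmorphism K -> K}) (e : int) (P : {poly K}) :
    q != 0 -> (-1 : K) != 1 -> neg q = - q -> inv q = q^-1 ->
    (forall k, q ^+ k.+1 != 1) -> A != 0 ->
    (size P <= 4)%N ->
    (forall theta, flip q theta -> map_poly theta P = (-1) ^ e *: P) ->
    f * A ^ e = (map_poly emb P).[A ^+ 2] ->
    P.[q ^+ 2] = q ^ e -> P.[q ^+ 4] = (q ^+ 2) ^ e -> f <> 1 ->
  exists m F,
    (F = - \sum_(0 <= j < m.+1) coeff (emb q) j * A ^- (2 * j + 8) \/
     F = - \sum_(0 <= j < m.+1) coeff (emb q) j * A ^+ (2 * j)) /\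
    f = 1 + (A ^+ 2 - emb q ^+ 2) * (A ^+ 2 - emb q ^+ 4)
            * (A ^+ 2 - emb q ^- 2) * (A ^+ 2 - emb q ^- 4) * F.
Proof.
move=> q0 neqN11 negq invq q_free A0 szP symP fP P2 P4 f1.
have [n en Pn] := symmetric_nodes q0 neqN11 negq invq symP P2 P4.
have t0 : emb q != 0 by rewrite fmorph_eq0.
have t_free k : emb q ^+ k.+1 != 1 by rewrite -rmorphXn fmorph_eq1.
have x0 : A ^+ 2 != 0 by rewrite expf_neq0.
have [||||m mE] :=
  interpolate_power t0 t_free x0 (P := map_poly emb P) (n := n) (f := f).
- by rewrite size_map_poly.
- move=> a; rewrite -2!rmorphXn -2!fmorphV -[[:: _; _; _; _]]/(map emb [:: _; _; _; _]).
  by move=> /mapP[b bn ->]; rewrite horner_map /= Pn // fmorphXz.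
- by rewrite -fP en expfzDr // expr2 expfzMl.
- exact: f1.
exists m; case: mE => ->; eexists; (split; last by []); [left | right].
  by congr (- _); apply: eq_bigr => j _; rewrite -exprM mulnDr.
by congr (- _); apply: eq_bigr => j _; rewrite -exprM.
Qed.

(** * Endomorphisms of the field Q(q) *)

Lemma frac_lift (R : idomainType) (K : fieldType) (f : {rmorphism R -> K}) :
    (forall x, f x = 0 -> x = 0) ->
  exists g : {rmorphism {fraction R} -> K}, forall x, g (FracField.tofrac x) = f x.
Proof.
move=> f_inj; have f0 x : x != 0 -> f x != 0 by apply: contra_neq; apply: f_inj.
have numden (x : {fraction R}) :
    x = FracField.tofrac \n_(repr x) / FracField.tofrac \d_(repr x).
  have dn0 : \d_(repr x) != 0 by exact: denom_ratioP.
  apply: (canRL (mulfK _)); first by rewrite tofrac_eq0.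
  rewrite -{1}[x]reprK; unlock FracField.tofrac.
  rewrite -[LHS]FracField.pi_mul; apply/eqmodP => /=.
  rewrite FracField.equivfE /FracField.mulf !numden_Ratio ?oner_eq0 ?mulr1 //.
  by rewrite mulrC.
pose g (x : {fraction R}) := f \n_(repr x) / f \d_(repr x).
have gE n d : d != 0 -> g (FracField.tofrac n / FracField.tofrac d) = f n / f d.
  move=> d0; rewrite /g; set x := FracField.tofrac n / FracField.tofrac d.
  have := numden x.
  have := denom_ratioP (repr x).
  set N := \n_(repr x); set D := \d_(repr x) => D0 /eqP.
  rewrite eqr_div ?tofrac_eq0 // -!rmorphM tofrac_eq => /eqP E.
  by apply/eqP; rewrite eqr_div ?f0 // -!rmorphM E.
have frac (x : {fraction R}) :
    exists n d, d != 0 /\ x = FracField.tofrac n / FracField.tofrac d.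
  by exists \n_(repr x), \d_(repr x); split; [exact: denom_ratioP | exact (numden x)].
have gB : zmod_morphism g.
  move=> x y; have [n [d [d0 ->]]] := frac x; have [m [e [e0 ->]]] := frac y.
  rewrite -mulNr addf_div ?tofrac_eq0 // -rmorphN -!rmorphM -rmorphD /=.
  rewrite !gE ?mulf_neq0 // -mulNr addf_div ?f0 //.
  by rewrite rmorphD !rmorphM rmorphN.
have gtofrac x : g (FracField.tofrac x) = f x.
  by rewrite -[FracField.tofrac x]divr1 -(tofrac1 R) gE ?oner_eq0 // rmorph1 divr1.
have gM : monoid_morphism g.
  split=> [|x y]; first by rewrite -(tofrac1 R) gtofrac rmorph1.
  have [n [d [d0 ->]]] := frac x; have [m [e [e0 ->]]] := frac y.
  by rewrite mulf_div -!rmorphM /= !gE ?mulf_neq0 // mulf_div !rmorphM.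
pose gb := GRing.isZmodMorphism.Build _ _ g gB.
pose gm := GRing.isMonoidMorphism.Build _ _ g gM.
by exists (HB.pack g gb gm : {rmorphism _ -> _}).
Qed.

Lemma q_neq0 : q != 0.
Proof. by rewrite tofrac_eq0 polyX_eq0. Qed.

Definition constq : rat -> Qq := @FracField.tofrac _ \o polyC.
HB.instance Definition _ := GRing.RMorphism.on constq.

(** The hypothesis says that [a] is transcendental over the rationals, so evaluation at [a] is
    injective and extends to fractions. *)
Lemma substitution (a : Qq) :
    (forall p : {poly rat}, (map_poly constq p).[a] = 0 -> p = 0) ->
  exists g : {rmorphism Qq -> Qq}, g q = a.
Proof.
move=> a_inj.
have [g gE] := @frac_lift _ _ (horner_eval a \o map_poly constq) a_inj.
by exists g; rewrite gE /= /horner_eval map_polyX hornerX.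
Qed.

Lemma horner_constq (p r : {poly rat}) :
  (map_poly constq p).[FracField.tofrac r] = FracField.tofrac (p \Po r).
Proof. by rewrite map_poly_comp horner_map. Qed.

Lemma negate_q : exists g : {rmorphism Qq -> Qq}, g q = - q.
Proof.
apply: substitution => p; rewrite -rmorphN horner_constq => /eqP.
by rewrite tofrac_eq0 comp_poly2_eq0 ?size_polyN ?size_polyX // => /eqP.
Qed.

Lemma invert_q : exists g : {rmorphism Qq -> Qq}, g q = q^-1.
Proof.
apply: substitution => p pq0; apply/eqP/negPn/negP => p0.
(* The reversed polynomial, equal to p(1/q) times a power of [q]; its constant term is the leading
   coefficient of [p]. *)
pose r := \poly_(i < size p) p`_((size p).-1 - i).
have : FracField.tofrac r = 0.
  rewrite -[RHS](mul0r (q ^+ (size p).-1)) -pq0.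
  rewrite (@horner_coef_wide _ (size p)) ?size_map_poly // mulr_suml.
  rewrite /r poly_def (reindex_inj rev_ord_inj) rmorph_sum /=.
  apply: eq_bigr => i _; have lti := ltn_ord i.
  have szE : (size p).-1 = (size p - i.+1 + i)%N.
    by rewrite -subn1 -[in LHS](subnK lti) addnS subn1.
  rewrite {1}szE addKn coef_map -mul_polyC rmorphM rmorphXn -mulrA /=.
  by congr (_ * _); rewrite szE exprVn exprD mulrCA mulVf ?mulr1 // expf_neq0 // q_neq0.
move/eqP; rewrite tofrac_eq0 => /eqP/(congr1 (fun u : {poly rat} => u`_0)) /eqP.
by rewrite coef_poly coef0 size_poly_gt0 p0 subn0 lead_coef_eq0 (negPf p0).
Qed.

(** * The embedding of Q(q) into Q(q)(A), and the conclusion *)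

Definition emb : Qq -> QqA := @FracField.tofrac _ \o polyC.
HB.instance Definition _ := GRing.RMorphism.on emb.

Lemma expq_inj m n : (q ^+ m == q ^+ n) = (m == n).
Proof.
rewrite -!rmorphXn tofrac_eq; apply/eqP/eqP => [E|-> //].
by have := congr1 (fun p : {poly rat} => size p) E; rewrite !size_polyXn => -[].
Qed.

Lemma A_neq0 : A != 0.
Proof. by rewrite tofrac_eq0 polyX_eq0. Qed.

Lemma z_neq0 : q - q^-1 != 0.
Proof.
apply/negP; rewrite subr_eq0 => /eqP qE; have := expq_inj 2 0.
by rewrite expr2 {1}qE mulVf ?q_neq0 // expr0 eqxx.
Qed.

Lemma horner_emb_A2 (P : {poly Qq}) :
  (map_poly emb P).[A ^+ 2] = FracField.tofrac (P \Po 'X^2).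
Proof. by rewrite -rmorphXn map_poly_comp horner_map. Qed.

Theorem theorem3p2 (H : seq slice -> QqA) (hH : is_HOMFLY H)
    (w : braid_word 4) (hK : is_knot (braid_closure w))
    (hJ : jones H (braid_closure w) = 1) (hH1 : H (braid_closure w) <> 1) :
  exists (m : nat) (F : QqA),
    (F = - \sum_(0 <= j < m.+1)
             (qnum qA (2 * j + 4) * qnum qA (j + 3) * qnum qA (j + 1))
             / (qnum qA 3 * qnum qA 4) * A ^- (2 * j + 8)
     \/
     F = - \sum_(0 <= j < m.+1)
             (qnum qA (2 * j + 4) * qnum qA (j + 3) * qnum qA (j + 1))
             / (qnum qA 3 * qnum qA 4) * A ^+ (2 * j)) /\
    H (braid_closure w) =
      1 + (A ^+ 2 - qA ^+ 2) * (A ^+ 2 - qA ^+ 4)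
          * (A ^+ 2 - qA ^- 2) * (A ^+ 2 - qA ^- 4) * F.
Proof.
pose u : word := [seq (nat_of_ord g.1, g.2) | g <- w].
have wu : braid_closure w = closure 4 u.
  by rewrite /braid_closure /closure /crosses -map_comp.
have lowu : below 3 u.
  by apply/allP=> _ /mapP[g _ ->]; apply: ltn_ord.
case: hH => Hi Hu Hs.
have [P [szP symP fP P2]] :=
  laurent_closure (emb := emb) q_neq0 z_neq0 A_neq0 Hi Hu Hs lowu.
set e := (X in _ ^ X) in symP fP P2.
rewrite -wu in fP.
(* The Jones polynomial is the value at A = q^2, where A^2 becomes q^4. *)
have P4 : P.[q ^+ 4] = (q ^+ 2) ^ e.
  have := frac_eval_exprz (p := P \Po 'X^2) (expf_neq0 2 q_neq0)
    (etrans fP (horner_emb_A2 P)).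
  rewrite -/(jones H _) hJ mul1r horner_comp hornerXn -exprM => ->; reflexivity.
have [neg negq] := negate_q; have [inv invq] := invert_q.
have neqN11 : (-1 : Qq) != 1.
  by rewrite -(rmorph1 constq) -rmorphN (inj_eq (fmorph_inj constq)).
have q_free k : q ^+ k.+1 != 1 by have := expq_inj k.+1 0; rewrite expr0 => ->.
exact: (trivial_jones q_neq0 neqN11 negq invq q_free A_neq0 szP symP fP P2 P4 hH1).
Qed.
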